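(* Let $\mathbb U$ and $\mathbb V$ be Banach spaces with $\dim\mathbb V\ge2$, and let $B:\mathbb U\to\mathbb V^*$ be a linear operator with $\gamma_B\|w\|_{\mathbb U}\le\|Bw\|_{\mathbb V^*}\le M_B\|w\|_{\mathbb U}$ for all $w\in\mathbb U$, where $M_B>0$ and $\gamma_B>0$. Assume that $\mathbb V$ and $\mathbb V^*$ are reflexive and strictly convex. Let $\mathbb U_n\subset\mathbb U$ and $\mathbb V_m\subset\mathbb V$ be finite-dimensional subspaces such that the Fortin condition holds: there exist an operator $\Pi:\mathbb V\to\mathbb V_m$ and constants $C_\Pi>0$, $D_\Pi>0$ such that $\|\Pi v\|_{\mathbb V}\le C_\Pi\|v\|_{\mathbb V}$ and $\|v-\Pi v\|_{\mathbb V}\le D_\Pi\|v\|_{\mathbb V}$ for all $v\in\mathbb V$, and $\langle Bw_n,v-\Pi v\rangle_{\mathbb V^*,\mathbb V}=0$ for all $w_n\in\mathbb U_n$ and $v\in\mathbb V$. Given $f\in\mathbb V^*$, there exists a unique solution $(r_m,u_n)\in\mathbb V_m\times\mathbb U_n$ of $$\langle J_{\mathbb V}(r_m),v_m\rangle_{\mathbb V^*,\mathbb V}+\langle Bu_n,v_m\rangle_{\mathbb V^*,\mathbb V}=\langle f,v_m\rangle_{\mathbb V^*,\mathbb V}\quad\forall v_m\in\mathbb V_m,\qquad\langle Bw_n,r_m\rangle_{\mathbb V^*,\mathbb V}=0\quad\forall w_n\in\mathbb U_n .$$ Moreover, if $u\in\mathbb U$ is such that $Bu=f$, then $$\|r_m\|_{\mathbb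 V}\le\|f\|_{\mathbb V^*}\le M_B\|u\|_{\mathbb U}$$ and $$\|u_n\|_{\mathbb U}\le\frac{C_\Pi}{\gamma_B}\bigl(1+C_{\mathrm{AO}}(\mathbb V)\bigr)\|f\|_{\mathbb V^*}\le\frac{C_\Pi}{\gamma_B}\bigl(1+C_{\mathrm{AO}}(\mathbb V)\bigr)M_B\|u\|_{\mathbb U},$$ where $C_{\mathrm{AO}}(\mathbb V)\in[0,1]$ is the asymmetric-orthogonality constant of $\mathbb V$.
   Context: All spaces are real. For a normed space $\mathbb Y$, the duality mapping is $\mathcal J_{\mathbb Y}(y)=\{y^*\in\mathbb Y^*:\langle y^*,y\rangle=\|y\|_{\mathbb Y}^2=\|y^*\|_{\mathbb Y^*}^2\}$. A normed space is strictly convex if $\|\theta y_1+(1-\theta)y_2\|<1$ whenever $y_1\ne y_2$, $\|y_1\|=\|y_2\|=1$, $\theta\in(0,1)$. If $\mathbb Y$ and $\mathbb Y^*$ are strictly convex and reflexive Banach spaces, then $\mathcal J_{\mathbb Y}(y)=\{J_{\mathbb Y}(y)\}$ is single-valued and $J_{\mathbb Y}:\mathbb Y\to\mathbb Y^*$ is a bijection (known fact). Asymmetric-orthogonality constant (for $\dim\mathbb Y\ge2$): $$C_{\mathrm{AO}}(\mathbb Y):=\sup\left\{\frac{\langle z_0^*,z\rangle_{\mathbb Y^*,\mathbb Y}}{\|z\|_{\mathbb Y}\|z_0\|_{\mathbb Y}}:(z_0,z)\in\mathcal O_{\mathbb Y},\ z_0^*\in\mathcal J_{\mathbb Y}(z_0)\right\},$$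 $\mathcal O_{\mathbb Y}:=\{(z_0,z)\in\mathbb Y\times\mathbb Y:\exists z^*\in\mathcal J_{\mathbb Y}(z)\text{ with }\langle z^*,z_0\rangle=0\}$ (the supremum being over nonzero $z_0,z$). *)

(* Defs.v *)
From HB Require Import structures.
From mathcomp Require Import all_boot all_order all_algebra.
From mathcomp Require Import all_classical all_reals all_analysis.

Set Implicit Arguments.
Unset Strict Implicit.
Unset Printing Implicit Defensive.

Import Order.TTheory GRing.Theory Num.Theory.
Import numFieldNormedType.Exports.

Local Open Scope classical_set_scope.
Local Open Scope ring_scope.

Section Dual.
Context {R : realType} (V : normedModType R).

Definition continuous_linear_form : {pred V -> R^o} :=
  [pred f : V -> R^o | `[< linear f /\ continuous f >]].

Record dual := Dual {
  dual_fun :> V -> R^o ;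
  dual_funP : dual_fun \in continuous_linear_form
}.

HB.instance Definition _ := [isSub for dual_fun].
HB.instance Definition _ := [Choice of dual by <:].

Lemma continuous_linear_form_submod_closed :
  submod_closed continuous_linear_form.
Proof.
split; first by apply/asboolP; split;
  [move=> a x y; rewrite scaler0 addr0 | exact: cst_continuous].
move=> a f g /asboolP[lf cf] /asboolP[lg cg]; apply/asboolP; split.
  move=> b x y; rewrite !fctE lf lg !scalerDr !scalerA addrACA.
  by rewrite (mulrC a b).
by move=> x; apply: cvgD; [apply: cvgZl_tmp; exact: cf | exact: cg].
Qed.

HB.instance Definition _ := GRing.isSubmodClosed.Build _ _
  continuous_linear_form continuous_linear_form_submod_closed.
HB.instance Definition _ := [SubChoice_isSubLmodule of dual by <:].

Lemma dual_linear (f : dual) : linear f.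
Proof. by case: f => f /= /asboolP[]. Qed.

HB.instance Definition _ (f : dual) :=
  GRing.isLinear.Build R V R^o *:%R f (@dual_linear f).

Lemma dual_continuous (f : dual) : continuous f.
Proof. by case: f => f /= /asboolP[]. Qed.

Lemma dualP (f g : dual) : f =1 g -> f = g.
Proof. by move=> fg; apply/val_inj/funext. Qed.

Definition dual_norm (f : dual) : R :=
  sup [set `|f v : R| | v in [set v : V | `|v| <= 1]].

Lemma dual_norm_has_sup (f : dual) :
  has_sup [set `|f v : R| | v in [set v : V | `|v| <= 1]].
Proof.
split; first by exists `|f 0 : R|, 0 => //=; rewrite normr0.
have /linear_bounded_continuous/bounded_funP/(_ 1)[M fM] :=
  @dual_continuous f.
by exists M => _ [v /= v1 <-]; exact: fM.
Qed.

Lemma dual_norm_ge0 (f : dual) : 0 <= dual_norm f.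
Proof.
apply: (@le_trans _ _ `|f 0 : R|) => //.
apply: sup_upper_bound; first exact: dual_norm_has_sup.
by exists 0 => //=; rewrite normr0.
Qed.

Lemma ler_dual_norm (f : dual) (v : V) : `|f v : R| <= dual_norm f * `|v|.
Proof.
have [->|v0] := eqVneq v 0; first by rewrite linear0 !normr0 mulr0.
have nv : 0 < `|v| by rewrite normr_gt0.
rewrite -ler_pdivrMr//.
have -> : `|f v : R| / `|v| = `|f (`|v|^-1 *: v) : R|.
  by rewrite linearZ /= normrM ger0_norm ?invr_ge0// mulrC.
apply: sup_upper_bound; first exact: dual_norm_has_sup.
by exists (`|v|^-1 *: v) => //=; rewrite normrZ ger0_norm ?invr_ge0// mulVf ?gt_eqF.
Qed.

Lemma dual_norm_le (f : dual) (c : R) :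
  (forall v, `|v| <= 1 -> `|f v : R| <= c) -> dual_norm f <= c.
Proof.
move=> fc; apply: ge_sup; first by case: (dual_norm_has_sup f).
by move=> _ [v /= v1 <-]; exact: fc.
Qed.

Lemma dual_normD (f g : dual) : dual_norm (f + g) <= dual_norm f + dual_norm g.
Proof.
apply: dual_norm_le => v v1; rewrite (le_trans (ler_normD _ _))//.
by apply: lerD; rewrite (le_trans (ler_dual_norm _ _))// ler_piMr// dual_norm_ge0.
Qed.

Lemma dual_norm0_eq0 (f : dual) : dual_norm f = 0 -> f = 0.
Proof.
move=> f0; apply: dualP => v; apply/eqP; rewrite -normr_le0.
by have := ler_dual_norm f v; rewrite f0 mul0r.
Qed.

Lemma dual_normZ_le (a : R) (f : dual) :
  dual_norm (a *: f) <= `|a| * dual_norm f.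
Proof.
apply: dual_norm_le => v v1; rewrite [`|_|]normrM ler_wpM2l//.
by rewrite (le_trans (ler_dual_norm _ _))// ler_piMr// dual_norm_ge0.
Qed.

Lemma dual_normZ (a : R) (f : dual) : dual_norm (a *: f) = `|a| * dual_norm f.
Proof.
apply/eqP; rewrite eq_le dual_normZ_le /=.
have [->|a0] := eqVneq a 0; first by rewrite normr0 mul0r dual_norm_ge0.
rewrite -ler_pdivlMl ?normr_gt0// -normfV.
have {1}-> : f = a^-1 *: (a *: f) by rewrite scalerA mulVf// scale1r.
exact: dual_normZ_le.
Qed.

HB.instance Definition _ := Lmodule_isNormed.Build R dual
  dual_normD dual_normZ dual_norm0_eq0.

Lemma dual_normE (f : dual) :
  `|f| = sup [set `|f v : R| | v in [set v : V | `|v| <= 1]].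
Proof. by []. Qed.

End Dual.

Section LinearNotions.
Context {R : realType}.

Definition dim_ge (n : nat) (E : lmodType R) : Prop :=
  exists e : 'I_n -> E, forall a : 'I_n -> R,
    \sum_(i < n) a i *: e i = 0 -> forall i, a i = 0.

Definition finite_dim_subspace (E : lmodType R) (S : set E) : Prop :=
  exists (n : nat) (e : 'I_n -> E),
    S = [set \sum_(i < n) a i *: e i | a in [set: 'I_n -> R]].

End LinearNotions.

Section BanachGeometry.
Context {R : realType}.

Definition strictly_convex (Y : normedModType R) : Prop :=
  forall (y1 y2 : Y) (t : R), y1 <> y2 -> `|y1| = 1 -> `|y2| = 1 ->
    0 < t < 1 -> `|t *: y1 + (1 - t) *: y2| < 1.

(* The canonical embedding of [Y] into its bidual is onto. *)
Definition reflexive_space (Y : normedModType R) : Prop :=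
  forall phi : dual (dual Y), exists y : Y, forall f : dual Y, phi f = f y.

Definition duality_set (Y : normedModType R) (y : Y) : set (dual Y) :=
  [set f : dual Y | (f y : R) = `|y| ^+ 2 /\ `|y| ^+ 2 = `|f| ^+ 2].

(* The element of [duality_set y], which is a singleton as soon as [dual Y] is
   strictly convex.  The default value 0 is never used: [duality_set y] is
   nonempty by the Hahn-Banach theorem. *)
Definition duality_map (Y : normedModType R) (y : Y) : dual Y :=
  xget 0 (duality_set y).

Definition asym_orth (Y : normedModType R) (z0 z : Y) : Prop :=
  exists2 f : dual Y, duality_set z f & (f z0 : R) = 0.

(* The quotients are at most 1, and there is at least one of them when
   [dim_ge 2 Y], so that [sup] is then a genuine least upper bound. *)
Definition C_AO (Y : normedModType R) : R :=
  sup [set c : R | exists (z0 z : Y) (f0 : dual Y),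
    [/\ z0 <> 0, z <> 0, asym_orth z0 z, duality_set z0 f0 &
        c = (f0 z : R) / (`|z| * `|z0|)]].

End BanachGeometry.

Section MixedProblem.
Context {R : realType} (U V : normedModType R).

Definition mixed_solution (B : U -> dual V) (f : dual V) (Un : set U)
    (Vm : set V) (rm : V) (un : U) : Prop :=
  [/\ Vm rm, Un un,
      forall vm, Vm vm -> (duality_map rm vm : R) + (B un vm : R) = (f vm : R) &
      forall wn, Un wn -> (B wn rm : R) = 0].

End MixedProblem.

(* Main.v *)
(** Fix [f] and let [W] be a finite-dimensional subspace. The restriction of [f]
    to [W] attains its norm, and extending it by Hahn-Banach gives [z] in [W]
    with [J z = f] on [W]. Applied to [K], the subspace of [Vm] annihilated by
    [B Un], this yields [rm] with [J rm = f] on [K], and a functional on [Vm]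
    vanishing on [K] is a combination of the [B w_j], which yields [un].
    Uniqueness is the strict monotonicity of [J] together with the Fortin
    condition. Applied to [Vm] and the functional [B un], it yields [y] with
    [B un = J y] on [Vm], and [J y] annihilates [rm]. Hence
    [|y|^2 = f y - J rm y <= |f| |y| + C_AO |rm| |y|], and [|rm| <= |f|]. *)
From HB Require Import structures.
Require Import Defs.
From mathcomp Require Import all_boot all_order all_algebra.
From mathcomp Require Import all_classical all_reals all_analysis.
From mathcomp Require Import ring lra.
Set Implicit Arguments.
Unset Strict Implicit.
Unset Printing Implicit Defensive.
Import Order.TTheory GRing.Theory Num.Theory.
Import numFieldNormedType.Exports.
Local Open Scope classical_set_scope.
Local Open Scope ring_scope.

Lemma dual_sumE (R : realType) (V : normedModType R) (I : Type) (s : seq I)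
    (P : pred I) (F : I -> dual V) x :
  (\sum_(i <- s | P i) F i) x = \sum_(i <- s | P i) F i x.
Proof. exact: (big_morph (fun f : dual V => f x : R)). Qed.

Lemma dual_norm_ler (R : realType) (V : normedModType R) (f : dual V) x :
  `|f x : R| <= `|f| * `|x|.
Proof. exact: ler_dual_norm. Qed.

(** * The Hahn-Banach theorem with norm control *)

Section HahnBanach.
Context {R : realType} {V : normedModType R}.

(* Zorn's lemma is applied to graphs of partial linear functionals; the second
   condition at [x = 0] makes the relation single-valued. *)
Definition dominated_graph (k : R) (G : set (V * R)) : Prop :=
  (forall (a : R) x r y s, G (x, r) -> G (y, s) -> G (a *: x + y, a * r + s)) /\
  (forall x r, G (x, r) -> `|r| <= k * `|x|).

Lemma dominated_graph_fun (k : R) G x r s : dominated_graph k G ->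
  G (x, r) -> G (x, s) -> r = s.
Proof.
move=> [Glin Gk] Gr Gs; apply/eqP; rewrite eq_sym -subr_eq0 -normr_le0.
by have := Gk _ _ (Glin (-1) _ _ _ _ Gr Gs); rewrite scaleN1r addNr normr0 mulr0 mulN1r addrC.
Qed.

(** A value [c] at [x0] must satisfy [|c - s| <= k * |x0 - y|] for every [(y, s)] in [G]. By the
    triangle inequality each lower bound [s - k * |x0 - y|] lies below every upper bound, so the
    supremum of the lower bounds works. *)
Lemma dominated_graph_ext (k : R) G (x0 : V) : 0 <= k -> G !=set0 -> dominated_graph k G ->
  exists c, dominated_graph k [set (p.1 + t *: x0, p.2 + t * c) | p in G & t in [set: R]].
Proof.
move=> k0 [[y0 s0] G0] [Glin Gk].
have GB x r y s : G (x, r) -> G (y, s) -> `|r - s| <= k * `|x - y|.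
  move=> Gx Gy; have /Gk := Glin (-1) _ _ _ _ Gy Gx.
  by rewrite scaleN1r mulN1r ![- _ + _]addrC.
pose A := [set p.2 - k * `|x0 - p.1| | p in G].
have Aub y s : G (y, s) -> ubound A (s + k * `|x0 - y|).
  move=> Gy _ [[x r] /= Gx <-]; rewrite lerBlDr -addrA -lerBlDl.
  rewrite (le_trans (ler_norm _))// (le_trans (GB _ _ _ _ Gx Gy))// -mulrDr.
  rewrite ler_wpM2l//.
  by rewrite [leRHS]addrC [X in _ <= X + _]distrC ler_distD.
have Asup : has_sup A.
  split; first by exists (s0 - k * `|x0 - y0|), (y0, s0).
  by exists (s0 + k * `|x0 - y0|); exact: Aub.
have cP y s : G (y, s) -> `|sup A - s| <= k * `|x0 - y|.
  move=> Gy; rewrite ler_distl; apply/andP; split.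
    by apply: sup_upper_bound => //; exists (y, s).
  by apply: ge_sup; [case: Asup | exact: Aub].
exists (sup A); split.
  move=> a _ _ _ _ [[x r] /= Gx [t _ [<- <-]]] [[y s] /= Gy [u _ [<- <-]]].
  exists (a *: x + y, a * r + s); first exact: Glin.
  exists (a * t + u) => //=; congr pair.
    by rewrite scalerDr scalerDl scalerA addrACA.
  by rewrite mulrDr mulrDl mulrA addrACA.
move=> _ _ [[x r] /= Gx [t _ [<- <-]]].
have [->|t0] := eqVneq t 0; first by rewrite scale0r mul0r !addr0; exact: Gk.
(* Factoring [t] out of [x + t *: x0] reduces the bound to the one for [c] at the graph point over
   [- (t^-1 *: x)]. *)
have Gt : G (- (t^-1 *: x), - (t^-1 * r)).
  have Gz : G (0, 0).
    by have := Glin (-1) _ _ _ _ Gx Gx; rewrite scaleN1r mulN1r !addNr.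
  by have := Glin (- t^-1) _ _ _ _ Gx Gz; rewrite !addr0 scaleNr mulNr.
have := cP _ _ Gt; rewrite !opprK => ct.
have -> : r + t * sup A = t * (sup A + t^-1 * r).
  by rewrite mulrDr mulrA mulfV// mul1r addrC.
have -> : x + t *: x0 = t *: (x0 + t^-1 *: x).
  by rewrite scalerDr scalerA mulfV// scale1r addrC.
by rewrite normrM normrZ mulrCA ler_wpM2l.
Qed.

Lemma hahn_banach (k : R) (G0 : set (V * R)) : 0 <= k -> G0 !=set0 -> dominated_graph k G0 ->
  exists2 g : dual V, `|g| <= k & forall x r, G0 (x, r) -> g x = r.
Proof.
move=> k0 G0n G0d.
pose P G := G = set0 \/ (G0 `<=` G /\ dominated_graph k G).
have [F FP totF|A [PA maxA]] := @Zorn_bigcup _ P.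
  have [Fne|Fe] := pselect (exists2 X, F X & X !=set0); last first.
    left; apply/eqP/negPn/negP => /set0P[x [X FX Xx]]; apply: Fe; exists X => //.
    by exists x.
  right; have [X0 FX0 [x0 X0x0]] := Fne.
  have FD X x : F X -> X x -> G0 `<=` X /\ dominated_graph k X.
    by move=> FX Xx; case: (FP _ FX) => // X0e; move: Xx; rewrite X0e.
  split; first by move=> z /((FD _ _ FX0 X0x0).1) ?; exists X0.
  split; last by move=> x r [X FX Xx]; exact: (FD _ _ FX Xx).2.2.
  move=> a x r y s [X FX Xx] [Y FY Yy].
  have [XY|YX] := totF _ _ FX FY.
    exists Y => //; apply: (FD _ _ FY Yy).2.1 => //; exact: XY.
  exists X => //; apply: (FD _ _ FX Xx).2.1 => //; exact: YX.
have [G0A Ad] : G0 `<=` A /\ dominated_graph k A.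
  case: PA => // Ae; exfalso; apply: (maxA G0); last by right; split.
  rewrite Ae; split; first exact: sub0set.
  by case: G0n => z G0z /(_ _ G0z).
have An : A !=set0 by case: G0n => z /G0A; exists z.
have totA x : exists r, A (x, r).
  have [c] := dominated_graph_ext x k0 An Ad.
  set A' := (X in dominated_graph k X) => A'd.
  have AA' : A `<=` A'.
    by move=> [y s] Ay; exists (y, s) => //; exists 0 => //=; rewrite scale0r mul0r !addr0.
  have A'A : A' `<=` A.
    apply: contrapT => nA'A; apply: (maxA A') => //.
    right; split => //; exact: subset_trans AA'.
  (* By maximality the one-step extension adds nothing; it contains [(x, c)], obtained from [(0, 0)]
     in [A] with [t = 1]. *)
  have [z Az] := An; exists c; apply: A'A.
  have Az0 : A (0, 0).
    case: z Az => y s Ay; have := Ad.1 (-1) _ _ _ _ Ay Ay.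
    by rewrite scaleN1r mulN1r !addNr.
  by exists (0, 0) => //; exists 1 => //=; rewrite scale1r mul1r !add0r.
have [h hA] := choice totA.
have hlin : linear (h : V -> R^o).
  by move=> a x y; apply: (dominated_graph_fun Ad (hA _)); exact: Ad.1.
pose hl := GRing.isLinear.Build R V R^o *:%R (h : V -> R^o) hlin.
pose H : {linear V -> R^o} := HB.pack (h : V -> R^o) hl.
have hc : continuous (h : V -> R^o).
  apply: (linear_bounded_continuous H).1; apply/bounded_funP => M; exists (k * M) => x xM.
  by rewrite (le_trans (Ad.2 _ _ (hA x)))// ler_wpM2l.
have hin : (h : V -> R^o) \in @continuous_linear_form R V by apply/asboolP.
exists (Dual hin) => [|x r /G0A Axr]; last exact: dominated_graph_fun Ad (hA x) Axr.
apply: dual_norm_le => v v1; rewrite (le_trans (Ad.2 _ _ (hA v)))//.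
by rewrite ler_piMr.
Qed.

End HahnBanach.

(** * Norm attainment on finite-dimensional subspaces *)

Section FinDim.
Context {R : realType} {V : normedModType R}.

(** Hahn-Banach extends [t *: y |-> t * |y|^2] from the line through [y] with bound [|y|]; the value
    at [y] shows that the norm is not smaller. *)
Lemma duality_set_neq0 (y : V) : duality_set y !=set0.
Proof.
pose G := [set (t *: y, t * `|y| ^+ 2) | t in [set: R]].
have [|| g gy gG] := @hahn_banach _ _ `|y| G (normr_ge0 _).
- by exists (0 *: y, 0 * `|y| ^+ 2), 0.
- split=> [a _ _ _ _ [t _ [<- <-]] [u _ [<- <-]]|_ _ [t _ [<- <-]]].
    by exists (a * t + u) => //; rewrite scalerDl scalerA mulrDl mulrA.
  by rewrite normrM [X in _ * X]ger0_norm ?sqr_ge0// normrZ expr2 mulrCA.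
have gyE : g y = `|y| ^+ 2 by apply: gG; exists 1; rewrite ?scale1r ?mul1r.
exists g; split=> //; congr (_ ^+ 2); apply/eqP; rewrite eq_le gy andbT.
have [->|y0] := eqVneq y 0; first by rewrite normr0.
rewrite -(ler_pM2r (_ : 0 < `|y|)) ?normr_gt0//.
by rewrite -expr2 -gyE (le_trans (ler_norm _))// dual_norm_ler.
Qed.

Lemma duality_mapP (y : V) : duality_set y (duality_map y).
Proof. by have [g yg] := duality_set_neq0 y; exact: xgetI yg. Qed.

(** For [y <> 0] this says [g y = 1]. The form chosen also covers [y = 0], which arises below when a
    generator depends on the others. *)
Lemma dual_separates (y : V) : exists g : dual V, (g y : R) *: y = y.
Proof.
have [->|y0] := eqVneq y 0; first by exists 0; rewrite scaler0.
have [g [gy _]] := duality_set_neq0 y.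
exists ((`|y| ^+ 2)^-1 *: g); rewrite -[X in X *: _]/(_ * g y) gy.
by rewrite mulVf ?scale1r// expf_eq0 normr_eq0.
Qed.

(* [e] need not be free: [phi] is only one continuous choice of coefficients. *)
Lemma span_coord n (e : 'I_n -> V) : exists phi : 'I_n -> dual V,
  forall a : 'I_n -> R, let x := \sum_i a i *: e i in
    x = \sum_i (phi i x : R) *: e i.
Proof.
elim: n e => [|n IH] e; first by exists (fun=> 0) => a /=; rewrite !big_ord0.
have [phi phiP] := IH (e \o lift ord0).
pose P x := \sum_i (phi i x : R) *: e (lift ord0 i).
(* [P] fixes the span of the remaining generators, so [x - P x] is [a ord0 *: y]. Composing [g] with
   [x - P x] gives the new coordinate [phi0], and each old one is corrected by its value at
   [e ord0]. *)
pose y := e ord0 - P (e ord0).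
have [g gy] := dual_separates y.
pose phi0 : dual V := g - \sum_i (g (e (lift ord0 i)) : R) *: phi i.
exists (fun i => if unlift ord0 i is Some j
  then phi j - (phi j (e ord0) : R) *: phi0 else phi0).
move=> a x; rewrite big_ord_recl unlift_none.
under eq_bigr do rewrite liftK.
have phi0E : phi0 x = g (x - P x).
  rewrite linearB [X in _ - X]linear_sum.
  rewrite -[LHS]/(g x - (\sum_i (g (e (lift ord0 i)) : R) *: phi i) x).
  congr (_ - _); rewrite dual_sumE.
  by apply: eq_bigr => i _; rewrite linearZ; exact: mulrC.
have xP : x - P x = a ord0 *: y.
  rewrite /x big_ord_recl; set w := \sum_(i < n) _.
  have wP : w = P w by exact: phiP.
  have -> : P (a ord0 *: e ord0 + w) = a ord0 *: P (e ord0) + P w.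
    rewrite /P scaler_sumr -big_split; apply: eq_bigr => i _ /=.
    by rewrite linearD linearZ scalerDl scalerA.
  by rewrite -wP opprD addrACA subrr addr0 scalerBr.
have -> : \sum_i (phi i - (phi i (e ord0) : R) *: phi0) x *: e (lift ord0 i) =
   P x - phi0 x *: P (e ord0).
  rewrite /P scaler_sumr -sumrB; apply: eq_bigr => i _.
  by rewrite scalerA -scalerBl [phi0 x * _]mulrC.
rewrite addrCA -scalerBr -/y phi0E xP linearZ -scalerA gy -xP.
by rewrite addrC subrK.
Qed.

Lemma continuous_lincomb n (e : 'I_n -> V) :
  continuous (fun a : 'rV[R]_n => \sum_i a ord0 i *: e i).
Proof.
have -> : (fun a : 'rV[R]_n => \sum_i a ord0 i *: e i) =
    \sum_i (fun a : 'rV[R]_n => a ord0 i *: e i).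
  by apply/funext => a; rewrite fct_sumE.
elim/big_ind : _ => [|f g fc gc a|i _ a]; first exact: cst_continuous.
  exact: cvgD (fc a) (gc a).
have ci := @coord_continuous R 1 n ord0 i a.
exact: (@cvgZ _ _ _ _ _ (fun b : 'rV_n => b ord0 i) (fun=> e i) _ _ ci (cvg_cst _)).
Qed.

Lemma finite_dim_duality (W : set V) (f : dual V) : finite_dim_subspace W ->
  exists2 z, W z & exists2 g, duality_set z g & forall w, W w -> g w = f w.
Proof.
move=> [n [e ->]] {W}.
have [phi phiP] := span_coord e.
pose S (a : 'rV[R]_n) := \sum_i a ord0 i *: e i.
have Sc : continuous S by exact: continuous_lincomb.
(* Since [e] may be dependent, the condition [|S a| <= 1] alone need not bound [a]. The box restores
   compactness and loses no vector: every [x] in the unit ball of the span has the coordinates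
   [phi i x], which lie in it. *)
pose A := [set a : 'rV[R]_n | forall i, a ord0 i \in `[- `|phi i|, `|phi i|]]
  `&` [set a | `|S a| <= 1].
have Ac : compact A.
  apply: compact_closedI.
    apply: (@rV_compact _ _ (fun i => `[- `|phi i|, `|phi i|]%classic)) => i.
    exact: segment_compact.
  apply: (@closed_comp _ _ (fun a => `|S a|) [set x | x <= 1]); last exact: closed_le.
  by move=> a _; exact: cvg_norm (Sc a).
have S0 : S 0 = 0 by rewrite /S big1// => i _; rewrite mxE scale0r.
have A0 : A 0.
  by split=> /=; [move=> i; rewrite mxE in_itv /= oppr_le0 normr_ge0|rewrite S0 normr0].
have [|m /set_mem Am mmax] := @compact_EVT_max _ R (fun a => f (S a)) A (ex_intro _ _ A0) Ac.
  by apply: continuous_subspaceT => a; apply: continuous_comp;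
    [exact: Sc|exact: dual_continuous].
pose M := f (S m) : R.
have M0 : 0 <= M.
  by have := mmax 0 (mem_set A0); rewrite S0 linear0.
pose W := [set \sum_(i < n) a i *: e i | a in [set: 'I_n -> R]].
have WZ (a : R) x y : W x -> W y -> W (a *: x + y).
  move=> [b _ <-] [c _ <-]; exists (fun i => a * b i + c i) => //.
  by rewrite scaler_sumr -big_split; apply: eq_bigr => i _ /=; rewrite scalerDl scalerA.
have W0 : W 0 by exists (fun=> 0) => //; rewrite big1// => i _; rewrite scale0r.
have fM1 x : W x -> `|x| <= 1 -> f x <= M.
  move=> [a _ xE] x1; have := phiP a; rewrite /= xE => {}xE.
  have SE : S (\row_i phi i x) = x.
    by rewrite [RHS]xE /S; apply: eq_bigr => i _; rewrite mxE.
  rewrite -SE; apply: mmax; apply/mem_set; split; rewrite /= ?SE// => i.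
  by rewrite mxE in_itv /= -ler_norml (le_trans (dual_norm_ler _ _))// ler_piMr.
have fM x : W x -> `|f x : R| <= M * `|x|.
  have H y : W y -> f y <= M * `|y|.
    move=> Wy; have [->|y0] := eqVneq y 0; first by rewrite linear0 normr0 mulr0.
    have ny : 0 < `|y| by rewrite normr_gt0.
    have := WZ `|y|^-1 _ _ Wy W0; rewrite addr0 => /fM1.
    rewrite linearZ /= normrZ normfV normr_id mulVf ?gt_eqF// => /(_ (lexx _)).
    by rewrite ler_pdivrMl// mulrC.
  move=> Wx; rewrite ler_norml H// andbT lerNl -linearN -normrN; apply: H.
  by rewrite -scaleN1r -[_ *: _]addr0; exact: WZ.
have [|| g gM gf] := @hahn_banach _ _ M [set (x, f x : R) | x in W] M0.
- by exists (0, f 0 : R), 0.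
- split=> [a _ _ _ _ [x Wx [<- <-]] [y Wy [<- <-]]|_ _ [x Wx [<- <-]]]; last exact: fM.
  by exists (a *: x + y); [exact: WZ|rewrite linearP].
have WS : W (S m) by exists (fun i => m ord0 i).
have gS : g (S m) = M by apply: gf; exists (S m).
have Sm1 : `|S m| <= 1 by case: Am.
have gMS : M <= `|g| * `|S m|.
  by rewrite -gS (le_trans (ler_norm _)) ?dual_norm_ler.
have gE : `|g| = M.
  by apply/eqP; rewrite eq_le gM /= (le_trans gMS)// ler_piMr.
(* [S m] has norm 1 unless [M = 0], so [M *: S m] has norm [M = |g|] in either case, and [g] takes
   the value [M^2] there. *)
exists (M *: S m); first by rewrite -[_ *: _]addr0; exact: WZ.
exists g => [|w Ww]; last by apply: gf; exists w.
have nz : `|M *: S m| = M.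
  by rewrite normrZ ger0_norm//; apply/eqP; rewrite eq_le ler_piMr//= -{2}gE.
by split; rewrite nz ?gE// linearZ /= gS expr2.
Qed.

End FinDim.

(** * Strict convexity, the duality mapping and the constant [C_AO] *)

Lemma strictly_convex_eq (R : realType) (Y : normedModType R) (x y : Y) :
  strictly_convex Y -> `|x| = `|y| -> 2 * `|x| <= `|x + y| -> x = y.
Proof.
move=> scY xy x2; apply: contrapT => xneqy.
have nx : 0 < `|x|.
  rewrite normr_gt0; apply/eqP => x0; apply: xneqy; rewrite x0.
  by apply/esym/normr0_eq0; rewrite -xy x0 normr0.
have unit_norm (z : Y) : `|z| = `|x| -> `|(`|x|^-1 *: z)| = 1.
  by move=> zx; rewrite normrZ normfV normr_id zx mulVf ?gt_eqF.
(* The midpoint of the two normalised vectors would have norm below 1, contradicting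
   [2 * |x| <= |x + y|]. *)
have := scY (`|x|^-1 *: x) (`|x|^-1 *: y) 2^-1 _ (unit_norm _ erefl) (unit_norm _ (esym xy)).
have -> : 1 - 2^-1 = 2^-1 :> R by field.
rewrite -scalerDr -scalerDr !normrZ !normfV normr_id gtr0_norm//.
rewrite mulrCA ltr_pdivrMl// mulr1 ltr_pdivrMl//.
move=> H; have : `|x + y| < 2 * `|x|.
  apply: H; last by lra.
  by move/scalerI => /(_ (lt0r_neq0 _)); rewrite invr_gt0 nx => /(_ isT).
by rewrite ltNge x2.
Qed.

Section Duality.
Context {R : realType} {V : normedModType R}.
Implicit Types (x y z : V) (f g : dual V).

Lemma duality_set_norm x f : duality_set x f -> `|f| = `|x|.
Proof. by move=> [_ /eqP]; rewrite eqrXn2// => /eqP. Qed.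

Lemma duality_setN x f : duality_set x f -> duality_set (- x) (- f).
Proof. by move=> [fx xf]; split; rewrite !normrN// linearN -[X in - X]/(- f x) opprK. Qed.

(** Both functionals have norm [|x|], and [(f + g) x = 2 * |x|^2] forces [|f + g| >= 2 * |x|]. *)
Lemma duality_set_inj x f g : strictly_convex (dual V) ->
  duality_set x f -> duality_set x g -> f = g.
Proof.
move=> scV xf xg; have [fx gx] := (duality_set_norm xf, duality_set_norm xg).
apply: strictly_convex_eq => //; first by rewrite fx gx.
have [x0|x0] := eqVneq x 0; first by rewrite fx x0 normr0 mulr0.
rewrite -(ler_pM2r (_ : 0 < `|x|)) ?normr_gt0//.
rewrite (le_trans _ (dual_norm_ler _ _))// (le_trans _ (ler_norm _))//.
by rewrite -[leRHS]/(f x + g x) xf.1 xg.1 fx -mulrA -expr2 mulr_natl.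
Qed.

(** The pairing is at least [(|x| - |y|)^2], so the norms agree. Then [f y >= |x|^2], hence
    [f (x + y) >= 2 * |x|^2] and [|x + y| >= 2 * |x|]. *)
Lemma duality_set_strict_monotone x y f g : strictly_convex V ->
  duality_set x f -> duality_set y g -> (f - g) (x - y) <= 0 -> x = y.
Proof.
move=> scV xf yg; have [fx gy] := (duality_set_norm xf, duality_set_norm yg).
rewrite -[leLHS]/(f (x - y) - g (x - y)) !linearB /= xf.1 yg.1.
have := le_trans (ler_norm _) (dual_norm_ler f y); rewrite fx => fy.
have := le_trans (ler_norm _) (dual_norm_ler g x); rewrite gy => gx fgxy.
have xy : `|x| = `|y|.
  apply/eqP; rewrite -subr_eq0 -sqrf_eq0 eq_le sqr_ge0 andbT; nra.
apply: strictly_convex_eq => //.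
have [x0|x0] := eqVneq x 0; first by rewrite x0 normr0 mulr0.
rewrite -(ler_pM2r (_ : 0 < `|x|)) ?normr_gt0//.
rewrite [leRHS]mulrC -[in leRHS]fx (le_trans _ (dual_norm_ler _ _))//.
rewrite (le_trans _ (ler_norm _))//.
rewrite linearD /= xf.1; move: fgxy gx fy; rewrite -xy; nra.
Qed.

Let quotients := [set c : R | exists (z0 z : V) (f0 : dual V),
    [/\ z0 <> 0, z <> 0, asym_orth z0 z, duality_set z0 f0 &
        c = (f0 z : R) / (`|z| * `|z0|)]].

Let quotients_le1 : ubound quotients 1.
Proof.
move=> _ [z0 [z [f [/eqP z00 /eqP z1 _ z0f ->]]]].
rewrite ler_pdivrMr ?mulr_gt0 ?normr_gt0// mul1r mulrC -(duality_set_norm z0f).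
exact: le_trans (ler_norm _) (dual_norm_ler _ _).
Qed.

(** Replacing [z] by [- z] preserves orthogonality. This symmetry makes the supremum nonnegative and
    lets it bound absolute values. *)
Let quotientsN c : quotients c -> quotients (- c).
Proof.
move=> [z0 [z [f [z00 z1 [g zg gz0] z0f ->]]]].
exists z0, (- z), f; split=> //.
- by move=> /eqP; rewrite oppr_eq0 => /eqP.
- by exists (- g); [exact: duality_setN | rewrite -[LHS]/(- g z0) gz0 oppr0].
- by rewrite linearN normrN mulNr.
Qed.

Lemma C_AO_itv : 0 <= C_AO V <= 1.
Proof.
rewrite /C_AO -/quotients.
(* With no quotients at all, [sup] takes its default value 0. *)
have [->|/set0P[c Qc]] := eqVneq quotients set0; first by rewrite sup0 lexx ler01.
have Qsup : has_sup quotients by split; [exists c | exists 1].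
apply/andP; split; last by apply: ge_sup => //; exists c.
have := sup_upper_bound Qsup Qc.
have := sup_upper_bound Qsup (quotientsN Qc).
by lra.
Qed.

Lemma ler_C_AO z0 z f : asym_orth z0 z -> duality_set z0 f ->
  `|f z : R| <= C_AO V * (`|z| * `|z0|).
Proof.
move=> z0z z0f.
have [z00|/eqP z00] := eqVneq z0 0.
  have := dual_norm_ler f z.
  by rewrite (duality_set_norm z0f) z00 normr0 mul0r !mulr0.
have [->|/eqP z1] := eqVneq z 0; first by rewrite linear0 !normr0 mul0r mulr0.
have zz0 : 0 < `|z| * `|z0| by rewrite mulr_gt0// normr_gt0; exact/eqP.
have Q : quotients (f z / (`|z| * `|z0|)) by exists z0, z, f.
have Qsup : has_sup quotients by split; [exists (f z / (`|z| * `|z0|)) | exists 1].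
have := sup_upper_bound Qsup Q.
have := sup_upper_bound Qsup (quotientsN Q).
rewrite -mulNr !ler_pdivrMr// lerNl ler_norml => -> /=.
exact.
Qed.

End Duality.

(** * Linear algebra of finitely many functionals on a finite-dimensional subspace *)

Section FiniteDimFunctionals.
Context {R : realType} {V : normedModType R}.

(** The rows of the left kernel of the matrix [h j (e i)] are coefficient vectors of generators.
    There are [n] of them, possibly dependent, as [finite_dim_subspace] permits. *)
Lemma finite_dim_annihilated (W : set V) m (h : 'I_m -> dual V) :
  finite_dim_subspace W -> finite_dim_subspace [set v | W v /\ forall j, h j v = 0].
Proof.
move=> [n [e ->]].
pose M := \matrix_(i < n, j < m) h j (e i) : 'M[R]_(n, m).
have hE (a : 'rV[R]_n) j : h j (\sum_i a ord0 i *: e i) = (a *m M) ord0 j.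
  by rewrite linear_sum mxE; apply: eq_bigr => i _; rewrite linearZ mxE.
exists n, (fun i => \sum_j kermx M i j *: e j); apply/seteqP; split=> v.
  move=> [[a _ <-]] ha; pose ra := \row_i a i.
  have raE : \sum_i a i *: e i = \sum_i ra ord0 i *: e i.
    by apply: eq_bigr => i _; rewrite mxE.
  have /submxP[b rab] : (ra <= kermx M)%MS.
    apply/sub_kermxP/rowP => j; rewrite -hE -raE mxE; exact: ha.
  exists (fun i => b ord0 i) => //; rewrite raE rab.
  under eq_bigr do rewrite scaler_sumr.
  rewrite exchange_big; apply: eq_bigr => j _; rewrite mxE scaler_suml.
  by apply: eq_bigr => i _; rewrite scalerA.
move=> [b _ <-]; pose a := (\row_i b i) *m kermx M.
have -> : \sum_i b i *: \sum_j kermx M i j *: e j = \sum_j a ord0 j *: e j.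
  under eq_bigr do rewrite scaler_sumr.
  rewrite exchange_big; apply: eq_bigr => j _; rewrite mxE scaler_suml.
  by apply: eq_bigr => i _; rewrite scalerA; congr (_ * _ *: _); rewrite mxE.
split; first by exists (fun i => a ord0 i).
by move=> j; rewrite hE -mulmxA mulmx_ker mulmx0 mxE.
Qed.

Lemma lincomb_of_annihilated (W : set V) m (h : 'I_m -> dual V) (k : dual V) :
  finite_dim_subspace W ->
  (forall v, W v -> (forall j, h j v = 0) -> k v = 0) ->
  exists c : 'I_m -> R, forall v, W v -> k v = \sum_j c j * h j v.
Proof.
move=> [n [e ->]] kh.
pose M := \matrix_(i < n, j < m) h j (e i) : 'M[R]_(n, m).
pose K := \col_i k (e i) : 'cV[R]_n.
(* The rows of [N] span the left kernel of [M], hence give vectors of [W] annihilated by all [h j].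
   The hypothesis becomes [N *m K = 0], which puts [K] in the column space of [M]. *)
pose N := (cokermx M^T)^T.
have NM : N *m M = 0 by rewrite -[M]trmxK -trmx_mul mulmx_coker trmx0.
have NK : N *m K = 0.
  apply/matrixP => l j; rewrite !mxE.
  rewrite -[RHS](kh (\sum_i N l i *: e i)).
  - by rewrite linear_sum; apply: eq_bigr => i _; rewrite linearZ !mxE.
  - by exists (N l).
  - move=> j'; have /matrixP/(_ l j') := NM; rewrite !mxE => <-.
    by rewrite linear_sum; apply: eq_bigr => i _; rewrite linearZ !mxE.
have /submxP[c /(congr1 trmx)] : (K^T <= M^T)%MS.
  by rewrite submxE -[cokermx _]trmxK -trmx_mul NK trmx0.
rewrite trmx_mul !trmxK => Kc; exists (fun j => c ord0 j) => v [a _ <-].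
rewrite linear_sum.
under [RHS]eq_bigr do rewrite linear_sum mulr_sumr.
rewrite exchange_big; apply: eq_bigr => i _.
have /matrixP/(_ i ord0) := Kc; rewrite !mxE => kE.
rewrite linearZ /= kE -[LHS]/(_ * _) mulr_sumr; apply: eq_bigr => j _.
by rewrite linearZ !mxE /= -[_ *: _]/(_ * _); ring.
Qed.

End FiniteDimFunctionals.

(** * Stability, existence and uniqueness for the mixed problem *)

Section Fortin.
Context {R : realType} {U V : normedModType R}.

Lemma mixed_solution_bound (B : U -> dual V) (f : dual V) (Un : set U)
    (Vm : set V) (Pi : V -> V) (CPi : R) (rm : V) (un : U) :
  finite_dim_subspace Vm -> 0 <= CPi ->
  (forall v, Vm (Pi v)) -> (forall v, `|Pi v| <= CPi * `|v|) ->
  (forall v, (B un (v - Pi v) : R) = 0) ->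
  mixed_solution B f Un Vm rm un ->
  `|rm| <= `|f| /\ `|B un| <= CPi * ((1 + C_AO V) * `|f|).
Proof.
move=> Vm_fin CPi0 PiVm Pi_le Pi_orth [Vrm Uun eq1 eq2].
have Jr := duality_mapP rm.
have rf : `|rm| <= `|f|.
  (* Testing the first equation with [rm] gives [|rm|^2 = f rm], the term in [B un] vanishing by the
     second equation. *)
  have [->|r0] := eqVneq rm 0; first by rewrite normr0.
  rewrite -(ler_pM2r (_ : 0 < `|rm|)) ?normr_gt0// -expr2 -Jr.1.
  rewrite (le_trans _ (dual_norm_ler _ _))// (le_trans _ (ler_norm _))//.
  by rewrite -(eq1 _ Vrm) (eq2 _ Uun) addr0.
split=> //.
have [y Vy [g yg gB]] := finite_dim_duality (B un) Vm_fin.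
have ry : asym_orth rm y by exists g => //; rewrite gB// eq2.
have /andP[C0 C1] := @C_AO_itv R V.
have y_le : `|y| <= (1 + C_AO V) * `|f|.
  have [->|y0] := eqVneq y 0; first by rewrite normr0 mulr_ge0// addr_ge0.
  have yp : 0 < `|y| by rewrite normr_gt0.
  rewrite -(ler_pM2r yp) -expr2 -yg.1 gB//.
  have -> : B un y = f y - duality_map rm y by rewrite -(eq1 _ Vy) addrC addKr.
  rewrite (le_trans (ler_norm _))// (le_trans (ler_normB _ _))//.
  rewrite [leRHS](_ : _ = `|f| * `|y| + C_AO V * (`|y| * `|f|)); last by ring.
  apply: lerD; first exact: dual_norm_ler.
  by rewrite (le_trans (ler_C_AO ry Jr))// ler_wpM2l// ler_wpM2l.
apply: dual_norm_le => v v1.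
(* The Fortin operator moves the test vector into [Vm], where [B un] agrees with [g], at the cost of
   the factor [CPi]. *)
have -> : B un v = g (Pi v).
  by rewrite gB//; apply/eqP; rewrite -subr_eq0 -linearB; apply/eqP; exact: Pi_orth.
rewrite (le_trans (dual_norm_ler _ _))// (duality_set_norm yg) mulrC.
apply: ler_pM => //; rewrite (le_trans (Pi_le _))//.
by rewrite ler_piMr.
Qed.

Lemma mixed_solution_exists (B : {linear U -> dual V}) (f : dual V) (Un : set U)
    (Vm : set V) : strictly_convex (dual V) ->
  finite_dim_subspace Un -> finite_dim_subspace Vm ->
  exists p : V * U, mixed_solution B f Un Vm p.1 p.2.
Proof.
move=> scdV [m [w UnE]] Vm_fin.
pose h j := B (w j).
have [r [Vr hr] [g rg gf]] := finite_dim_duality f (finite_dim_annihilated h Vm_fin).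
have [v Vv hv|c cP] := lincomb_of_annihilated (h := h) (k := f - g) Vm_fin.
  by rewrite -[LHS]/(f v - g v) gf ?subrr//; split.
exists (r, \sum_j c j *: w j); split => //=.
- by rewrite UnE; exists c.
(* Strict convexity of the dual identifies the extension [g] with the chosen value
   [duality_map r]. *)
- move=> v Vv; rewrite (duality_set_inj scdV (duality_mapP r) rg).
  have -> : B (\sum_j c j *: w j) v = \sum_j c j * h j v.
    by rewrite linear_sum dual_sumE; apply: eq_bigr => j _; rewrite linearZ.
  by rewrite -(cP _ Vv) addrC subrK.
- move=> u; rewrite UnE => -[a _ <-]; rewrite linear_sum dual_sumE big1// => j _.
  by rewrite linearZ -[LHS]/(a j * h j r) hr mulr0.
Qed.

Lemma mixed_solution_unique (B : {linear U -> dual V}) (f : dual V) (Un : set U)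
    (Vm : set V) (Pi : V -> V) (gammaB : R) (r r' : V) (u u' : U) :
  strictly_convex V -> 0 < gammaB ->
  (forall w, gammaB * `|w| <= `|B w|) ->
  (forall v, Vm (Pi v)) ->
  (forall w v, Un w -> (B w (v - Pi v) : R) = 0) ->
  mixed_solution B f Un Vm r u -> mixed_solution B f Un Vm r' u' ->
  (r, u) = (r', u').
Proof.
move=> scV gB0 gB PiVm Pi_orth [Vr Uu eq1 eq2] [Vr' Uu' eq1' eq2'].
have rr' : r = r'.
  (* Tested with [r] and [r'], on which all the [B] terms vanish, both first equations give the same
     values of [f], so the monotonicity pairing is 0. *)
  apply: (duality_set_strict_monotone scV (duality_mapP r) (duality_mapP r')).
  rewrite -[leLHS]/(duality_map r (r - r') - duality_map r' (r - r')) !linearB /=.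
  have := eq1 _ Vr; have := eq1 _ Vr'; have := eq1' _ Vr; have := eq1' _ Vr'.
  rewrite !eq2// !eq2'//; lra.
(* With equal residuals [B u] and [B u'] agree on [Vm]; [Pi] carries this to all of [V], and the
   lower bound on [B] then yields [u = u']. *)
have BE v : B u v = B u' v.
  have BPi w : Un w -> B w v = B w (Pi v).
    by move=> Uw; apply/eqP; rewrite -subr_eq0 -linearB; apply/eqP; exact: Pi_orth.
  rewrite !BPi//; have := eq1 _ (PiVm v); have := eq1' _ (PiVm v).
  by rewrite -rr' => <- /addrI.
congr pair => //; apply/eqP; rewrite -subr_eq0 -normr_le0.
rewrite -(pmulr_rle0 _ gB0) (le_trans (gB _))// linearB normr_le0 subr_eq0.
by apply/eqP/dualP.
Qed.

End Fortin.

Theorem theorem4 (R : realType) (U V : completeNormedModType R)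
    (dimV : dim_ge 2 V)
    (B : {linear U -> dual V}) (MB gammaB : R)
    (MB_gt0 : 0 < MB) (gammaB_gt0 : 0 < gammaB)
    (B_bounds : forall w : U, gammaB * `|w| <= `|B w| <= MB * `|w|)
    (V_refl : reflexive_space V) (V_sconvex : strictly_convex V)
    (dV_refl : reflexive_space (dual V)) (dV_sconvex : strictly_convex (dual V))
    (Un : set U) (Vm : set V)
    (Un_fin : finite_dim_subspace Un) (Vm_fin : finite_dim_subspace Vm)
    (Pi : V -> V) (CPi DPi : R) (CPi_gt0 : 0 < CPi) (DPi_gt0 : 0 < DPi)
    (Pi_Vm : forall v : V, Vm (Pi v))
    (Pi_bound : forall v : V, `|Pi v| <= CPi * `|v|)
    (Pi_id_bound : forall v : V, `|v - Pi v| <= DPi * `|v|)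
    (Pi_orth : forall (wn : U) (v : V), Un wn -> (B wn (v - Pi v) : R) = 0)
    (f : dual V) :
  [/\ (exists! p : V * U, mixed_solution B f Un Vm p.1 p.2),
      (forall (rm : V) (un : U), mixed_solution B f Un Vm rm un ->
        forall u : U, B u = f ->
          `|rm| <= `|f| <= MB * `|u| /\
          `|un| <= CPi / gammaB * (1 + C_AO V) * `|f|
                <= CPi / gammaB * (1 + C_AO V) * MB * `|u|) &
      0 <= C_AO V <= 1].
Proof.
split; last exact: C_AO_itv.
- have [p Sp] := mixed_solution_exists B f dV_sconvex Un_fin Vm_fin.
  exists p; split=> // -[r' u'] Sp'; case: p Sp => r u Sp.
  apply: mixed_solution_unique V_sconvex gammaB_gt0 _ Pi_Vm Pi_orth Sp Sp'.
  by move=> w; have /andP[] := B_bounds w.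
- move=> rm un S u Bu.
  have Uun : Un un by case: S.
  have [rf Bun] := mixed_solution_bound Vm_fin (ltW CPi_gt0) Pi_Vm Pi_bound
    (fun v => Pi_orth _ v Uun) S.
  have fu : `|f| <= MB * `|u| by rewrite -Bu; have /andP[] := B_bounds u.
  split; first by rewrite rf.
  apply/andP; split.
    have /andP[gun _] := B_bounds un.
    rewrite -mulrA mulrAC ler_pdivlMr// mulrC.
    by rewrite (le_trans gun)// (le_trans Bun)// mulrA.
  rewrite -[leRHS]mulrA ler_wpM2l//.
  have /andP[C0 _] := @C_AO_itv R V.
  by rewrite mulr_ge0// ?addr_ge0// divr_ge0// ltW.
Qed.
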